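(* Let $E:=[a,b]\subset\mathbb R$ with $a<b$, let $g\in C^{(2)}(E)$, let $\mathbf x=(x_1,\dots,x_n)$ with all $x_i\in E$, and let $\mathbf p=(p_1,\dots,p_n)$ with $p_i>0$ and $\sum_{i=1}^n p_i=1$. Then $$\frac12 m_g(E)\Bigl[2\Bigl(\sum_{i=1}^n p_ix_i-a\Bigr)\Bigl(b-\sum_{i=1}^n p_ix_i\Bigr)-J_n(\mathbf p,\mathbf x;x^2)\Bigr]\le g(a)+g(b)-\sum_{i=1}^n p_ig(x_i)-g\Bigl(a+b-\sum_{i=1}^n p_ix_i\Bigr)$$ and $$g(a)+g(b)-\sum_{i=1}^n p_ig(x_i)-g\Bigl(a+b-\sum_{i=1}^n p_ix_i\Bigr)\le \frac12 M_g(E)\Bigl[2\Bigl(\sum_{i=1}^n p_ix_i-a\Bigr)\Bigl(b-\sum_{i=1}^n p_ix_i\Bigr)-J_n(\mathbf p,\mathbf x;x^2)\Bigr].$$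
   Context: $J_n(\mathbf p,\mathbf x;x^2):=\sum_{i=1}^n p_i x_i^2-\bigl(\sum_{i=1}^n p_i x_i\bigr)^2$, $m_g(E):=\min_{t\in E}g''(t)$ and $M_g(E):=\max_{t\in E}g''(t)$. *)

(* Defs.v *)
From mathcomp Require Import all_boot all_order all_algebra.
From mathcomp Require Import all_classical all_reals all_analysis.
Set Implicit Arguments.
Unset Strict Implicit.
Unset Printing Implicit Defensive.
Import Order.TTheory GRing.Theory Num.Theory.
Import numFieldNormedType.Exports.
Local Open Scope classical_set_scope.
Local Open Scope ring_scope.

(* A function on E is represented by a total function R -> R.  The increment is
   restricted to E, so that for E = [a, b] the derivatives at a and b are the
   one-sided ones and values outside E never matter. *)
Definition derivable_on (R : realType) (E : set R) (f : R -> R) (x : R) : Prop :=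
  cvg ((f y - f x) / (y - x) @[y --> within E x^']).

Definition derive_on (R : realType) (E : set R) (f : R -> R) (x : R) : R :=
  lim ((f y - f x) / (y - x) @[y --> within E x^']).

Definition derive2_on (R : realType) (E : set R) (f : R -> R) : R -> R :=
  derive_on E (derive_on E f).

Definition C2_on (R : realType) (E : set R) (f : R -> R) : Prop :=
  [/\ forall x, E x -> derivable_on E f x,
      forall x, E x -> derivable_on E (derive_on E f) x
    & {within E, continuous (derive2_on E f)}].

(* Default value 0 when the extremum is not attained. *)
Definition min_on (R : realType) (E : set R) (h : R -> R) : R :=
  xget 0 [set y | (h @` E) y /\ forall t, E t -> y <= h t].

Definition max_on (R : realType) (E : set R) (h : R -> R) : R :=
  xget 0 [set y | (h @` E) y /\ forall t, E t -> h t <= y].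

Lemma min_onP (R : realType) (a b : R) (h : R -> R) :
  a <= b -> {within `[a, b], continuous h} ->
  (h @` `[a, b]) (min_on `[a, b] h) /\
  forall t, `[a, b]%classic t -> min_on `[a, b] h <= h t.
Proof.
move=> ab hc; have [c cab ch] := EVT_min ab hc.
rewrite /min_on; case: xgetP => [y _ //|/(_ (h c)) []].
by split; [exists c | move=> t tab; exact: ch].
Qed.

Lemma max_onP (R : realType) (a b : R) (h : R -> R) :
  a <= b -> {within `[a, b], continuous h} ->
  (h @` `[a, b]) (max_on `[a, b] h) /\
  forall t, `[a, b]%classic t -> h t <= max_on `[a, b] h.
Proof.
move=> ab hc; have [c cab ch] := EVT_max ab hc.
rewrite /max_on; case: xgetP => [y _ //|/(_ (h c)) []].
by split; [exists c | move=> t tab; exact: ch].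
Qed.

Definition jensen (R : realType) (n : nat) (p x : 'I_n -> R) (f : R -> R) : R :=
  \sum_(i < n) p i * f (x i) - f (\sum_(i < n) p i * x i).

(* Main.v *)
Require Import Defs.
From mathcomp Require Import all_boot all_order all_algebra.
From mathcomp Require Import all_classical all_reals all_analysis.
From mathcomp Require Import ring lra.
Set Implicit Arguments.
Unset Strict Implicit.
Unset Printing Implicit Defensive.
Import Order.TTheory GRing.Theory Num.Theory.
Import numFieldNormedType.Exports.
Local Open Scope classical_set_scope.
Local Open Scope ring_scope.

(** For a convex h on [a, b], Mercer's form of Jensen's inequality says
    h(a + b - xbar) <= h(a) + h(b) - sum_i p_i h(x_i). The points
    a + b - x_i are the reflections of the x_i in the midpoint of [a, b], with
    weighted mean a + b - xbar, so Jensen gives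
    h(a + b - xbar) <= sum_i p_i h(a + b - x_i), and comparing h with its
    chord gives h(x_i) + h(a + b - x_i) <= h(a) + h(b). Both steps use
    convexity only through supporting lines ([mercer_supporting_lines]).

    If m <= g'' <= M on [a, b], then g - (m/2) t^2 and (M/2) t^2 - g are convex.
    Mercer's inequality for these two functions is the theorem, because the
    bracket 2 (xbar - a) (b - xbar) - J is exactly the Mercer gap of t^2.

    As all derivatives are one-sided at the endpoints of [a, b], the work left
    is to obtain the supporting lines from them. Caratheodory's slope function
    turns a derivative relative to [a, b] into continuity on [a, b] and an
    ordinary derivative in the interior, which is what the mean value theorem
    asks for ([derive_on_MVT]). Applied to g', it shows that the derivatives of
    the two auxiliary functions are nondecreasing on the closed interval;
    applied to the functions themselves, it then gives the supporting lines
    ([monotone_derivative_supporting_line]). *)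

Lemma convex_comb_itv (R : realFieldType) (n : nat) (p x : 'I_n -> R)
    (a b : R) :
  (forall i, a <= x i <= b) -> (forall i, 0 < p i) -> \sum_(i < n) p i = 1 ->
  a <= \sum_(i < n) p i * x i <= b.
Proof.
move=> hx hp hp1; rewrite -[a]mul1r -[b]mul1r -hp1 !mulr_suml.
by apply/andP; split; apply: ler_sum => i _; rewrite ler_pM2l ?hp//;
  case/andP: (hx i).
Qed.

(** The two weights (b - y) / (b - a) and (y - a) / (b - a) that write y as a
    combination of a and b are exchanged when y is reflected, so adding the
    chord bounds at y and a + b - y leaves weight one on each endpoint. *)
Lemma reflection_sum_le (R : realFieldType) (a b : R) (h dh : R -> R) :
  a < b ->
  (forall c y, a <= c <= b -> a <= y <= b -> h c + dh c * (y - c) <= h y) ->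
  forall y, a <= y <= b -> h y + h (a + b - y) <= h a + h b.
Proof.
move=> ab hs.
have chord y : a <= y <= b ->
    (b - a) * h y <= (b - y) * h a + (y - a) * h b.
  move=> yab; have /andP[ay yb] := yab.
  have ha : 0 <= h a - (h y + dh y * (a - y)).
    by rewrite subr_ge0 hs// lexx ltW.
  have hb : 0 <= h b - (h y + dh y * (b - y)).
    by rewrite subr_ge0 hs// lexx ltW.
  (* in this combination the slopes dh y cancel *)
  have hya : 0 <= b - y by rewrite subr_ge0.
  have hyb : 0 <= y - a by rewrite subr_ge0.
  by have := addr_ge0 (mulr_ge0 hya ha) (mulr_ge0 hyb hb); lra.
move=> y yab; have /andP[ay yb] := yab.
have c1 := chord y yab.
have c2 : (b - a) * h (a + b - y) <= (y - a) * h a + (b - y) * h b.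
  have := chord (a + b - y).
  rewrite (_ : b - (a + b - y) = y - a); last by ring.
  rewrite (_ : a + b - y - a = b - y); last by ring.
  by apply; apply/andP; split; lra.
rewrite -(ler_pM2l (_ : 0 < b - a)) ?subr_gt0//.
move: (lerD c1 c2); rewrite -mulrDr => /le_trans; apply.
by rewrite le_eqVlt; apply/orP; left; apply/eqP; ring.
Qed.

(** The supporting line at a + b - xbar yields Jensen's inequality at the
    reflected points: its linear part averages to zero. *)
Lemma mercer_supporting_lines (R : realFieldType) (n : nat)
    (p x : 'I_n -> R) (a b : R) (h dh : R -> R) :
  a < b ->
  (forall c y, a <= c <= b -> a <= y <= b -> h c + dh c * (y - c) <= h y) ->
  (forall i, a <= x i <= b) -> (forall i, 0 < p i) -> \sum_(i < n) p i = 1 ->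
  0 <= h a + h b - \sum_(i < n) p i * h (x i)
       - h (a + b - \sum_(i < n) p i * x i).
Proof.
move=> ab hs hx hp hp1.
have /andP[axb xbb] := convex_comb_itv hx hp hp1.
set xb := \sum_(i < n) p i * x i in axb xbb *; set c := a + b - xb.
have cab : a <= c <= b by rewrite /c; apply/andP; split; lra.
have termwise i : p i * (h c + dh c * (xb - x i)) <=
    p i * (h a + h b) - p i * h (x i).
  rewrite -mulrBr ler_pM2l ?hp//.
  have /andP[axi xib] := hx i.
  have := reflection_sum_le ab hs (hx i).
  have := hs c (a + b - x i) cab; rewrite (_ : a + b - x i - c = xb - x i);
    last by rewrite /c; ring.
  move=> /(_ _)/le_trans H1 H2; apply: H1; last by lra.
  by apply/andP; split; lra.
have := ler_sum (index_enum 'I_n) (fun i (_ : true) => termwise i).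
rewrite sumrB -mulr_suml hp1 mul1r.
have -> : \sum_(i < n) p i * (h c + dh c * (xb - x i)) = h c.
  under eq_bigr do rewrite mulrDr mulrCA mulrBr.
  rewrite big_split/= -mulr_suml hp1 mul1r -mulr_sumr sumrB -mulr_suml hp1.
  by rewrite mul1r subrr mulr0 addr0.
lra.
Qed.

(** The slope of f at x, completed by the derivative at z = x, is a total
    function whose continuity relative to E at x encodes differentiability
    without a punctured filter. In this form both continuity of f and, at
    interior points, ordinary differentiability are immediate. *)
Lemma derivable_on_caratheodory (R : realType) (E : set R) (f : R -> R)
    (x : R) :
  derivable_on E f x ->
  exists phi : R -> R, [/\ forall z, f z - f x = phi z * (z - x),
    phi z @[z --> within E (nbhs x)] --> phi x & phi x = derive_on E f x].
Proof.
move=> fx.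
exists (fun z => if z == x then derive_on E f x else (f z - f x) / (z - x)).
split; rewrite ?eqxx//.
- move=> z; case: eqP => [->|/eqP]; first by rewrite !subrr mulr0.
  by rewrite -subr_eq0 => /divfK->.
- (* the filters within E at x, punctured or not, differ only at x itself,
     where the completed slope takes the limit value *)
  move=> U /= Ux; have := fx U Ux.
  rewrite !nbhs_simpl/= /dnbhs /within /=.
  apply: (@filterS _ (nbhs x)) => z; case: eqP => [-> _ _|/eqP zx H Ez].
    exact: nbhs_singleton.
  exact: H.
Qed.

Lemma derivable_on_continuous (R : realType) (E : set R) (f : R -> R) :
  (forall x, E x -> derivable_on E f x) -> {within E, continuous f}.
Proof.
move=> fE; apply/subspace_continuousP => x Ex.
have [phi [phiE phic _]] := derivable_on_caratheodory (fE x Ex).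
have fE' : f = (fun z => f x + phi z * (z - x)).
  by apply/funext => z; rewrite -phiE addrC subrK.
suff : f x + phi z * (z - x) @[z --> within E (nbhs x)] -->
    f x + phi x * (x - x) by rewrite -phiE addrC subrK -fE'.
apply: cvgD; first exact: cvg_cst.
apply: cvgM => //; apply: cvgB; last exact: cvg_cst.
exact: cvg_within.
Qed.

Lemma derivable_on_is_derive (R : realType) (E : set R) (f : R -> R) (x : R) :
  E° x -> derivable_on E f x -> is_derive x 1 f (derive_on E f x).
Proof.
move=> Ex /derivable_on_caratheodory[phi [phiE phic phix]].
apply/is_derive1_caratheodory; exists phi; split => //.
by move: phic; rewrite within_interior.
Qed.

Lemma interior_itvcc (R : realType) (a b x : R) :
  a < x < b -> (`[a, b]%classic : set R)° x.
Proof.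
by move=> xab; rewrite interior_itv_bnd/= in_itv.
Qed.

Lemma derive_on_MVT (R : realType) (a b u v : R) (f : R -> R) :
  a <= u -> u < v -> v <= b ->
  (forall x, `[a, b]%classic x -> derivable_on `[a, b] f x) ->
  exists2 c, u < c < v & f v - f u = derive_on `[a, b] f c * (v - u).
Proof.
move=> au uv vb fab.
have sub : `[u, v] `<=` `[a, b].
  by move=> z /=; rewrite !in_itv/= => /andP[uz zv]; apply/andP; split; lra.
have [x||c] := @MVT R f (derive_on `[a, b] f) u v uv.
- rewrite in_itv/= => /andP[ux xv]; apply: derivable_on_is_derive.
    by apply: interior_itvcc; apply/andP; split; lra.
  by apply: fab; rewrite /= in_itv/=; apply/andP; split; lra.
- exact: continuous_subspaceW sub (derivable_on_continuous fab).
- by rewrite in_itv/= => uv' fE; exists c.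
Qed.

(** By the mean value theorem, h y - h c is (y - c) times the derivative at a
    point between c and y; whichever side of c this point is on, monotonicity
    makes the product at least dh c * (y - c). The point c may be an endpoint:
    there dh need not be a derivative of the total function h, and its
    monotonicity up to the endpoints is what bounds the slope. *)
Lemma monotone_derivative_supporting_line (R : realType) (a b : R)
    (h dh : R -> R) :
  {within `[a, b], continuous h} ->
  (forall x, a < x < b -> is_derive x 1 h (dh x)) ->
  (forall u v, a <= u -> u < v -> v <= b -> dh u <= dh v) ->
  forall c y, a <= c <= b -> a <= y <= b -> h c + dh c * (y - c) <= h y.
Proof.
move=> hc hd mono.
have mvt u v : a <= u -> u < v -> v <= b ->
    exists2 z, u < z < v & h v - h u = dh z * (v - u).
  move=> au uv vb; have [x||z] := @MVT R h dh u v uv.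
  - by rewrite in_itv/= => /andP[ux xv]; apply: hd; apply/andP; split; lra.
  - apply: continuous_subspaceW hc => z /=; rewrite !in_itv/= => /andP[uz zv].
    by apply/andP; split; lra.
  - by rewrite in_itv/= => uv' fE; exists z.
move=> c y /andP[ac cb] /andP[ay yb].
have [cy|yc|->] := ltgtP c y; last by rewrite subrr mulr0 addr0.
- have [z /andP[cz zy] E] := mvt c y ac cy yb.
  rewrite addrC -lerBrDr E ler_pM2r ?subr_gt0//.
  by apply: mono => //; lra.
- have [z /andP[yz zc] E] := mvt y c ay yc cb.
  rewrite -[h y](subrK (h c)) addrC lerD2r -opprB E -opprB mulrN lerN2.
  rewrite ler_pM2r ?subr_gt0//.
  by apply: mono => //; lra.
Qed.

Lemma is_derive_scale_sqr (R : realType) (k x : R) :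
  is_derive x 1 (fun t : R => 2^-1 * k * t ^+ 2) (k * x).
Proof.
have := is_deriveZ (2^-1 * k) (is_deriveX 2 (is_derive_id x (1 : R))).
rewrite [X in is_derive _ _ _ X -> _](_ : _ = k * x); last first.
  by rewrite /= expr1 /GRing.scale/= ; field.
by [].
Qed.

Lemma continuous_scale_sqr (R : realType) (k : R) (E : set R) :
  {within E, continuous (fun t : R => 2^-1 * k * t ^+ 2)}.
Proof.
apply: continuous_subspaceT => x.
by have [/derivable1_diffP/differentiable_continuous] := is_derive_scale_sqr k x.
Qed.

(** The bracket of the theorem arises as the Mercer gap of the quadratic that
    is subtracted from, or dominates, g: expanding (a + b - xbar)^2 turns
    a^2 + b^2 into the product (xbar - a) (b - xbar) and releases the squares
    that make up J. *)
Lemma mercer_gap_sqr (R : realType) (n : nat) (p x : 'I_n -> R) (a b k : R) :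
  let xbar := \sum_(i < n) p i * x i in
  2^-1 * k * a ^+ 2 + 2^-1 * k * b ^+ 2
    - \sum_(i < n) p i * (2^-1 * k * x i ^+ 2)
    - 2^-1 * k * (a + b - xbar) ^+ 2 =
  2^-1 * k * (2 * (xbar - a) * (b - xbar) - jensen p x (fun t => t ^+ 2)).
Proof.
move=> xbar; rewrite /jensen -/xbar.
under eq_bigr do rewrite mulrCA.
rewrite -mulr_sumr; ring.
Qed.

Theorem theorem2p17 (R : realType) (a b : R) (hab : a < b)
    (g : R -> R) (hg : C2_on `[a, b] g)
    (n : nat) (x p : 'I_n -> R)
    (hx : forall i, a <= x i <= b)
    (hp : forall i, 0 < p i) (hp1 : \sum_(i < n) p i = 1) :
  let xbar := \sum_(i < n) p i * x i in
  let m := min_on `[a, b] (derive2_on `[a, b] g) in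
  let M := max_on `[a, b] (derive2_on `[a, b] g) in
  let J := jensen p x (fun t => t ^+ 2) in
  let D := g a + g b - \sum_(i < n) p i * g (x i) - g (a + b - xbar) in
  2^-1 * m * (2 * (xbar - a) * (b - xbar) - J) <= D /\
  D <= 2^-1 * M * (2 * (xbar - a) * (b - xbar) - J).
Proof.
move=> xbar m M J D; case: hg => g1 g2 gc.
have [_ mle] := min_onP (ltW hab) gc.
have [_ leM] := max_onP (ltW hab) gc.
rewrite -/m in mle; rewrite -/M in leM.
have g'_incr u v : a <= u -> u < v -> v <= b ->
    m * (v - u) <= derive_on `[a, b] g v - derive_on `[a, b] g u
      <= M * (v - u).
  move=> au uv vb; have [c /andP[uc cv] ->] := derive_on_MVT au uv vb g2.
  have cab : `[a, b]%classic c.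
    by rewrite /= in_itv/=; apply/andP; split; lra.
  by rewrite !ler_pM2r ?subr_gt0// mle ?leM.
have gcont := derivable_on_continuous g1.
have gder y : a < y < b -> is_derive y 1 g (derive_on `[a, b] g y).
  move=> yab; apply: derivable_on_is_derive; first exact: interior_itvcc.
  by apply: g1; rewrite /= in_itv/=; case/andP: yab => *; rewrite !ltW.
split; rewrite /J -mercer_gap_sqr -subr_ge0.
- pose h := g - (fun t => 2^-1 * m * t ^+ 2).
  pose dh t := derive_on `[a, b] g t - m * t.
  have hs : forall c y, a <= c <= b -> a <= y <= b ->
      h c + dh c * (y - c) <= h y.
    apply: monotone_derivative_supporting_line.
    + move=> t; apply: cvgB; first exact: gcont.
      exact: continuous_scale_sqr.
    + by move=> t /gder tab; apply: is_deriveB => //; exact: is_derive_scale_sqr.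
    + move=> u v au uv vb; have /andP[+ _] := g'_incr u v au uv vb.
      by rewrite /dh; lra.
  have := mercer_supporting_lines hab hs hx hp hp1.
  rewrite /h !fctE; under eq_bigr do rewrite mulrBr.
  by rewrite sumrB /D -/xbar; lra.
- pose h := (fun t => 2^-1 * M * t ^+ 2) - g.
  pose dh t := M * t - derive_on `[a, b] g t.
  have hs : forall c y, a <= c <= b -> a <= y <= b ->
      h c + dh c * (y - c) <= h y.
    apply: monotone_derivative_supporting_line.
    + move=> t; apply: cvgB; last exact: gcont.
      exact: continuous_scale_sqr.
    + by move=> t /gder tab; apply: is_deriveB => //; exact: is_derive_scale_sqr.
    + move=> u v au uv vb; have /andP[_] := g'_incr u v au uv vb.
      by rewrite /dh; lra.
  have := mercer_supporting_lines hab hs hx hp hp1.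
  rewrite /h !fctE; under eq_bigr do rewrite mulrBr.
  by rewrite sumrB /D -/xbar; lra.
Qed.
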